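(* For every integer $d\ge1$ there exists an instance with $n^\ell=n^r=n$ (for some $n\ge d$) and $d^\ell=d^r=d$ in which, for every $c\in\{0,1,\ldots,d-1\}$, no matching is simultaneously $\frac{c+2}{d}$-DMMS and SD-DEF$c$.
   Context: Write $[n]=\{0,\ldots,n-1\}$. There are two disjoint groups of agents, $N^\ell=[n^\ell]$ (left) and $N^r=[n^r]$ (right). Every left agent has degree constraint $d^\ell$ and every right agent has degree constraint $d^r$. A (valid) matching is a binary $n^\ell\times n^r$ matrix $M$ in which every row sum is at most $d^\ell$ and every column sum is at most $d^r$; ''matching'' always means valid matching. Write $M^\ell_i=\{j\in N^r: M(i,j)=1\}$ and $M^r_j=\{i\in N^\ell: M(i,j)=1\}$. Each left agent $i$ has a valuation function $u^\ell_i:N^r\to\mathbb{R}_{\ge0}$ and each right agent $j$ a valuation function $u^r_j:N^\ell\to\mathbb{R}_{\ge0}$, extended additively to sets. Each left agent $i$ also has a linear order $\sigma^\ell_i$ over $N^r$ consistent with $u^\ell_i$ (agents with strictly larger value come earlier; ties broken arbitrarily), and each right agent $j$ a linear order $\sigma^r_j$ over $N^\ell$ consistent with $u^r_j$; $\sigma(p)$ denotes the agent in position $p$, position $0$ being the most preferred. An instance consists of the sizes, degree constraints, valuation functions and rankings. Let $\mathcal{M}$ be the set of valid matchings. The maximin share values are $MMS^\ell_i=\max_{M\in\mathcal{M}}\min_{i'\in N^\ell}u^\ell_i(M^\ell_{i'})$ and $MMS^r_j=\max_{M\in\mathcal{M}}\min_{j'\in N^r}u^r_j(M^r_{j'})$.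 For $\alpha\ge0$, a matching $M$ is $\alpha$-DMMS if $u^\ell_i(M^\ell_i)\ge\alpha\cdot MMS^\ell_i$ for every $i\in N^\ell$ and $u^r_j(M^r_j)\ge\alpha\cdot MMS^r_j$ for every $j\in N^r$. $M$ is SD-EF$c$ over $N^\ell$ if for all $i,i'\in N^\ell$ and all $t\in[n^r]$, $\sum_{p=0}^t M(i,\sigma^\ell_i(p))\ge \sum_{p=0}^t M(i',\sigma^\ell_i(p))-c$; it is SD-EF$c$ over $N^r$ if for all $j,j'\in N^r$ and all $t\in[n^\ell]$, $\sum_{p=0}^t M(\sigma^r_j(p),j)\ge \sum_{p=0}^t M(\sigma^r_j(p),j')-c$. $M$ is SD-DEF$c$ if it is SD-EF$c$ over both $N^\ell$ and $N^r$. *)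

(* Defs.v *)
From HB Require Import structures.
From mathcomp Require Import all_boot all_order all_algebra all_fingroup.
From mathcomp Require Import reals.

Set Implicit Arguments.
Unset Strict Implicit.
Unset Printing Implicit Defensive.

Import Order.TTheory GRing.Theory Num.Theory.
Local Open Scope ring_scope.

(* A ranking [s] lists the agents by position ([s p] is the agent in position
   [p], position 0 being the most preferred); a linear order on 'I_n is thus
   a permutation of 'I_n. *)
Definition consistent (R : realType) (n : nat) (u : 'I_n -> R) (s : 'S_n) :
    Prop :=
  forall p q : 'I_n, u (s q) < u (s p) -> (p < q)%N.

Record instance (R : realType) (nl nr : nat) := Instance {
  dl : nat;
  dr : nat;
  ul : 'I_nl -> 'I_nr -> R;
  ur : 'I_nr -> 'I_nl -> R;
  sigl : 'I_nl -> 'S_nr;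
  sigr : 'I_nr -> 'S_nl;
  ul_ge0 : forall i j, 0 <= ul i j;
  ur_ge0 : forall j i, 0 <= ur j i;
  sigl_consistent : forall i, consistent (ul i) (sigl i);
  sigr_consistent : forall j, consistent (ur j) (sigr j)
}.

Section Matchings.
Variables (R : realType) (nl nr : nat) (I : instance R nl nr).
Implicit Type M : 'M[bool]_(nl, nr).

Definition matching M : bool :=
  [forall i, (\sum_j M i j <= dl I)%N] && [forall j, (\sum_i M i j <= dr I)%N].

Definition nbl M (i : 'I_nl) : {set 'I_nr} := [set j | M i j].
Definition nbr M (j : 'I_nr) : {set 'I_nl} := [set i | M i j].

Definition vall (i : 'I_nl) (A : {set 'I_nr}) : R := \sum_(j in A) ul I i j.
Definition valr (j : 'I_nr) (A : {set 'I_nl}) : R := \sum_(i in A) ur I j i.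

(* The default value of each iterated min (resp. max) is one of the values
   being compared: the share of the agent itself (resp. the value at the empty
   matching, which is valid), so these are genuine minima and maxima. *)
Definition minl (i : 'I_nl) M : R :=
  \big[Num.min/vall i (nbl M i)]_(i' < nl) vall i (nbl M i').
Definition minr (j : 'I_nr) M : R :=
  \big[Num.min/valr j (nbr M j)]_(j' < nr) valr j (nbr M j').

Definition MMSl (i : 'I_nl) : R :=
  \big[Num.max/minl i (const_mx false)]_(M : 'M[bool]_(nl, nr) | matching M)
    minl i M.
Definition MMSr (j : 'I_nr) : R :=
  \big[Num.max/minr j (const_mx false)]_(M : 'M[bool]_(nl, nr) | matching M)
    minr j M.

Definition DMMS (alpha : R) M : Prop :=
  (forall i, alpha * MMSl i <= vall i (nbl M i)) /\
  (forall j, alpha * MMSr j <= valr j (nbr M j)).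

(* The inequality S >= S' - c is written S' <= S + c, as subtraction on nat
   is truncated. *)
Definition SDEFl (c : nat) M : Prop :=
  forall (i i' : 'I_nl) (t : 'I_nr),
    (\sum_(p < nr | p <= t) M i' (sigl I i p) <=
     \sum_(p < nr | p <= t) M i (sigl I i p) + c)%N.
Definition SDEFr (c : nat) M : Prop :=
  forall (j j' : 'I_nr) (t : 'I_nl),
    (\sum_(p < nl | p <= t) M (sigr I j p) j' <=
     \sum_(p < nl | p <= t) M (sigr I j p) j + c)%N.

Definition SDDEF (c : nat) M : Prop := SDEFl c M /\ SDEFr c M.

End Matchings.

(* Main.v *)
Require Import Defs.
From mathcomp Require Import all_boot all_order all_algebra all_fingroup.
From mathcomp Require Import reals.
From mathcomp Require Import zify.

Import Order.TTheory GRing.Theory Num.Theory.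
Local Open Scope ring_scope.

(** Let [n = d^2 + d]. All left agents agree: they value the right agents
    [0 .. d-1] at [d] ("big"), [d .. 2d-1] at [1] ("medium") and the others
    at [0]; the right agents are indifferent. Giving one big agent each to
    [d^2] left agents, and all [d] medium ones to each of the remaining [d]
    left agents, shows that the maximin share is at least [d]. In any
    matching the [d] big agents have [d^2 < n] slots, so some left agent [i] has no big one and needs at least [c+2] medium ones.
    SD-EFc on the first [2d] positions then gives every left agent at least 2
    agents among the big and medium ones, whose [2d^2 < 2n] slots do not
    suffice. *)

Lemma sum_interval (n a d : nat) :
  (\sum_(i < n) (a <= i < a + d) = minn (n - a) d)%N.
Proof.
elim: n => [|n IHn]; first by rewrite big_ord0; lia.
by rewrite big_ord_recr /= IHn; lia.
Qed.

Lemma sum_sub_interval (n a d : nat) (P : pred 'I_n) :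
  (forall i, P i -> (a <= i < a + d)%N) -> (\sum_i P i <= d)%N.
Proof.
move=> sP; apply: (@leq_trans (\sum_(i < n) (a <= i < a + d))%N).
  by apply: leq_sum => i _; case: (boolP (P i)) => // /sP ->.
by rewrite sum_interval geq_minr.
Qed.

(** Double counting: the first [k] columns hold at most [k * d] ones, too few to give each of the
    [m] rows [q] of them. *)
Lemma row_prefix_pigeonhole (m n d k q : nat) (M : 'M[bool]_(m, n)) :
  (forall j, (\sum_i M i j <= d)%N) -> (k * d < q * m)%N ->
  exists i, (\sum_(j < n | j < k) M i j < q)%N.
Proof.
move=> colM ltkq; apply/existsP/contraT => /existsPn rowM.
have le_qm : (q * m <= \sum_i \sum_(j < n | j < k) M i j)%N.
  rewrite -{1}(card_ord m) mulnC -sum_nat_const; apply: leq_sum => i _.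
  by rewrite leqNgt rowM.
suff : (\sum_i \sum_(j < n | j < k) M i j <= k * d)%N by lia.
rewrite exchange_big /=.
apply: (@leq_trans (\sum_(j < n | j < k) d)%N).
  by apply: leq_sum => j _; apply: colM.
rewrite sum_nat_const leq_mul2r -sum1_card big_mkcond; apply/orP; right.
apply: (@leq_trans (\sum_(j < n) (0 <= j < 0 + k))%N).
  by apply: leq_sum => j _; rewrite unfold_in -[eqn _ _]/(j < k)%N; case: (j < k)%N.
by rewrite sum_interval geq_minr.
Qed.

Lemma MMSl_ge (R : realType) (nl nr : nat) (I : instance R nl nr)
    (M : 'M[bool]_(nl, nr)) (i : 'I_nl) (x : R) :
  matching I M -> (forall i', x <= vall I i (nbl M i')) -> x <= MMSl I i.
Proof.
move=> mM leM; apply: le_trans (le_bigmax_cond _ _ mM).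
by apply: le_bigmin => // i' _.
Qed.

Section Instance.
Variables (R : realType) (d : nat).
Let n := (d * d + d)%N.

Definition weight (j : nat) : nat := if (j < d)%N then d else (j < d + d)%N.

Definition weight_instance : instance R n n.
Proof.
(* Identity rankings are consistent: on the left [weight] is nonincreasing in the index, on the
   right all values tie. *)
refine (@Instance R n n d d (fun _ j => (weight j)%:R) (fun _ _ => 0)
          (fun _ => 1%g) (fun _ => 1%g) _ _ _ _) => //.
by move=> _ p q; rewrite !perm1 ltr_nat /weight; do 2!case: ifP; lia.
by move=> _ p q; rewrite ltxx.
Defined.

Lemma vall_weight (M : 'M[bool]_n) (i i' : 'I_n) :
  vall weight_instance i (nbl M i') = (\sum_j M i' j * weight j)%:R.
Proof.
rewrite /vall -natr_sum big_mkcond; congr (_%:R); apply: eq_bigr => j _ /=.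
by rewrite inE; case: (M i' j); rewrite ?mul1n ?mul0n.
Qed.

Definition share_matching : 'M[bool]_n :=
  \matrix_(i, j) (if j < d then j * d <= i < j * d + d
                  else (j < d + d) && (d * d <= i))%N.

Lemma matching_share : matching weight_instance share_matching.
Proof.
apply/andP; split; apply/forallP => i /=.
  (* Rows below [d * d] meet only big columns, the others only medium ones: either way a window of
     length [d]. *)
  apply: (@sum_sub_interval _ (if i < d * d then 0 else d)%N) => j.
  rewrite mxE; case: ifP; case: ifP; try lia.
  by move=> /negbT; nia.
apply: (@sum_sub_interval _ (if i < d then i * d else d * d)%N) => j.
rewrite mxE; case: ifP; first by [].
by have := ltn_ord j; rewrite {2}/n; lia.
Qed.

Lemma MMSl_weight_ge (i : 'I_n) : (0 < d)%N -> d%:R <= MMSl weight_instance i.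
Proof.
move=> d_gt0; apply: MMSl_ge matching_share _ => i'.
rewrite vall_weight ler_nat; have [lti|lei] := ltnP i' (d * d).
  (* The big agent assigned to [i'] is [i' %/ d]. *)
  have ltq : (i' %/ d < d)%N by rewrite ltn_divLR.
  have ltqn : (i' %/ d < n)%N by rewrite /n; lia.
  rewrite (bigD1 (Ordinal ltqn)) //= mxE /= /weight ltq leq_divM /=.
  by rewrite -mulSnr ltn_ceil // mul1n leq_addr.
apply: (@leq_trans (\sum_(j < n) (d <= j < d + d))%N).
  by rewrite sum_interval /n; nia.
apply: leq_sum => j _; rewrite mxE /weight lei.
by case: ltnP => //= _; case: ltnP.
Qed.

Lemma weight_instance_unfair (c : nat) (M : 'M[bool]_n) :
  (0 < d)%N -> matching weight_instance M ->
  DMMS weight_instance ((c + 2)%:R / d%:R) M -> ~ SDEFl weight_instance c M.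
Proof.
move=> d_gt0 /andP[_ /forallP /= colM] [mmsM _] efM.
have [|i] := @row_prefix_pigeonhole _ _ d d 1 M colM.
  by rewrite /n; lia.
rewrite ltnS leqn0 sum_nat_eq0 => /forallP no_big.
have [|i' le1] := @row_prefix_pigeonhole _ _ d (d + d) 2 M colM.
  by rewrite /n; nia.
(* Prefix sums in [SDEFl] include position [t], so the first [d + d] agents end at [(d + d).-1]. *)
have lt_t : ((d + d).-1 < n)%N by rewrite /n; nia.
have prefixE i0 : (\sum_(p < n | p <= Ordinal lt_t)
    M i0 (sigl weight_instance i0 p) = \sum_(j < n | j < d + d) M i0 j)%N.
  by apply: eq_big => [p|p _] /=; [lia | rewrite perm1].
have := efM i' i (Ordinal lt_t); rewrite !prefixE.
(* As [i'] holds at most one agent of this prefix, SD-EFc would allow [i] at most [c + 1]. *)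
suff : (c + 2 <= \sum_(j < n | j < d + d) M i j)%N by lia.
(* Since [i] holds no big agent, each agent it holds is worth 1 inside the prefix and 0 beyond. *)
have le_val : (\sum_j M i j * weight j <= \sum_(j < n | j < d + d) M i j)%N.
  rewrite [leqRHS]big_mkcond; apply: leq_sum => j _ /=.
  have := no_big j; rewrite /weight; case: ltnP => /= [_ /eqP -> //|_ _].
  by case: ltnP; rewrite ?muln1 ?muln0.
apply: leq_trans le_val; rewrite -(ler_nat R) -(vall_weight M i i).
apply: le_trans (mmsM i); have d_gt0R : 0 < d%:R :> R by rewrite ltr0n.
by rewrite -mulrA ler_peMr ?ler0n // mulrC ler_pdivlMr // mul1r MMSl_weight_ge.
Qed.

End Instance.

Theorem theorem5 (R : realType) (d : nat) (hd : (1 <= d)%N) :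
  exists (n : nat) (I : instance R n n),
    [/\ (d <= n)%N, dl I = d, dr I = d &
      forall c : nat, (c < d)%N ->
        ~ exists M : 'M[bool]_(n, n),
            [/\ matching I M, DMMS I ((c + 2)%:R / d%:R) M & SDDEF I c M]].
Proof.
exists (d * d + d)%N, (weight_instance R d); split=> //; first exact: leq_addl.
by move=> c _ [M [mM dM [efM _]]]; exact: (weight_instance_unfair _ _ _ _ hd mM dM efM).
Qed.
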